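(* Let $\mathbb{K}$ be a field of characteristic different from $3$, and let $R$ be the $\mathbb{K}$-algebra generated by $f_2,f_3,f_4,f_5,f_6$ subject to the defining relations \begin{align*} f_3f_2&=f_2f_3, & f_4f_2&=f_2f_4, & f_4f_3&=f_3f_4, & f_5f_2&=f_2f_5, & f_5f_4&=f_4f_5, & f_6f_3&=f_3f_6,\\ f_6f_4&=f_4f_6, & f_6f_5&=f_5f_6, & f_4^2&=1/9, & f_6f_2&=f_2f_6+1, & f_5f_3&=f_3f_5-1. \end{align*} Set $\mathbb{F}=\mathbb{K}[f_4]/\langle f_4^2-1/9\rangle$. Then $R\cong A_2(\mathbb{F})$, where $A_2(\mathbb{F})$ is the second Weyl algebra over the ring $\mathbb{F}$.
   Context: For a commutative ring $\mathbb{F}$, the second Weyl algebra $A_2(\mathbb{F})$ is the $\mathbb{F}$-algebra generated by $x_1,x_2,y_1,y_2$ with relations $x_1x_2=x_2x_1$, $y_1y_2=y_2y_1$, $x_1y_2=y_2x_1$, $x_2y_1=y_1x_2$, $x_1y_1-y_1x_1=1$, $x_2y_2-y_2x_2=1$. In $\mathbb{K}[f_4]$ defining $\mathbb{F}$, $f_4$ is a polynomial indeterminate. *)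

(* Defs.v *)
From HB Require Import structures.
From mathcomp Require Import all_boot all_order all_algebra.
From mathcomp Require Import boolp.
From mathcomp Require Import finmap monalg.

Set Implicit Arguments.
Unset Strict Implicit.
Unset Printing Implicit Defensive.

Import GRing.Theory.

Local Open Scope ring_scope.
Local Open Scope quotient_scope.

Section TwoSidedIdeal.
Context (A : nzRingType) (S : A -> Prop).

Inductive ideal_gen : A -> Prop :=
| ideal_gen0 : ideal_gen 0
| ideal_gen_add a s b u :
    S s -> ideal_gen u -> ideal_gen (a * s * b + u).

Lemma ideal_gen_gen s : S s -> ideal_gen s.
Proof.
by move=> Ss; have := ideal_gen_add 1 1 Ss ideal_gen0; rewrite mul1r mulr1 addr0.
Qed.

Lemma ideal_genD u v : ideal_gen u -> ideal_gen v -> ideal_gen (u + v).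
Proof.
move=> Iu Iv; elim: Iu => [|a s b w Ss _ IHw]; first by rewrite add0r.
by rewrite -addrA; apply: ideal_gen_add.
Qed.

Lemma ideal_genM c u d : ideal_gen u -> ideal_gen (c * u * d).
Proof.
elim=> [|a s b w Ss _ IHw]; first by rewrite mulr0 mul0r; apply: ideal_gen0.
rewrite mulrDr mulrDl !mulrA -(mulrA (c * a * s)).
exact: ideal_gen_add.
Qed.

Lemma ideal_genMl c u : ideal_gen u -> ideal_gen (c * u).
Proof. by move=> /(ideal_genM c 1); rewrite mulr1. Qed.

Lemma ideal_genMr d u : ideal_gen u -> ideal_gen (u * d).
Proof. by move=> /(ideal_genM 1 d); rewrite mul1r. Qed.

Lemma ideal_genN u : ideal_gen u -> ideal_gen (- u).
Proof. by move=> /(ideal_genMl (-1)); rewrite mulN1r. Qed.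

End TwoSidedIdeal.

Notation free_alg F I := {malg F[{fmonom I}]}.

Notation free_gen F i := (mkmalgU (fmu i) (1 : F)).

(* {malg F[M]} has an algType instance only for commutative monoids M. *)
Fact free_alg_scalerAr (F : comNzRingType) (I : choiceType) (c : F)
  (u v : free_alg F I) : c *: (u * v) = u * (c *: v).
Proof.
rewrite (malgMEw (fsubset_refl _) (msuppZ_le c v)) malgME scaler_sumr.
apply: eq_bigr => k _; rewrite scaler_sumr; apply: eq_bigr => l _.
apply/malgP => m; rewrite mcoeffZ !mcoeffU mcoeffZ mulrnAr.
by rewrite mulrCA.
Qed.

Section PresentedAlgebra.
Context (F : comNzRingType) (I : choiceType).
Context (rels : seq (free_alg F I * free_alg F I)).

Definition relator (s : free_alg F I) : Prop :=
  exists2 r, r \in rels & s = r.1 - r.2.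

Definition pres_eq (u v : free_alg F I) : bool :=
  `[< ideal_gen relator (u - v) >].

Fact pres_eq_refl : reflexive pres_eq.
Proof. by move=> u; apply/asboolP; rewrite subrr; apply: ideal_gen0. Qed.

Fact pres_eq_sym : symmetric pres_eq.
Proof.
by move=> u v; apply/asboolP/asboolP => /ideal_genN; rewrite opprB.
Qed.

Fact pres_eq_trans : transitive pres_eq.
Proof.
move=> v u w /asboolP Iuv /asboolP Ivw; apply/asboolP.
by rewrite -(subrKA v); apply: ideal_genD.
Qed.

Canonical pres_equiv :=
  EquivRel pres_eq pres_eq_refl pres_eq_sym pres_eq_trans.

(* The F-algebra generated by I subject to the relations r.1 = r.2 for r in
   rels. It may be the zero ring, so it is a priori only a pzRingType. *)
Definition pres_alg := {eq_quot pres_equiv}.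

HB.instance Definition _ := Choice.on pres_alg.
HB.instance Definition _ := EqQuotient.on pres_alg.

Definition pres_pi (u : free_alg F I) : pres_alg := \pi u.

Lemma pres_piP u v : pres_pi u = pres_pi v <-> ideal_gen relator (u - v).
Proof.
by split=> [/eqquotP/asboolP | Iuv] //; apply/eqquotP/asboolP.
Qed.

Lemma pres_repr_pi u : ideal_gen relator (repr (pres_pi u) - u).
Proof. by apply/pres_piP; rewrite /pres_pi reprK. Qed.

Lemma pres_pi_repr (x : pres_alg) : pres_pi (repr x) = x.
Proof. exact: reprK. Qed.

Let zero : pres_alg := pres_pi 0.
Let opp (x : pres_alg) := pres_pi (- repr x).
Let add (x y : pres_alg) := pres_pi (repr x + repr y).
Let one : pres_alg := pres_pi 1.
Let mul (x y : pres_alg) := pres_pi (repr x * repr y).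
Let scale (c : F) (x : pres_alg) := pres_pi (c *: repr x).

Let oppE u : opp (pres_pi u) = pres_pi (- u).
Proof. by apply/pres_piP; rewrite -opprD; apply/ideal_genN/pres_repr_pi. Qed.

Let addE u v : add (pres_pi u) (pres_pi v) = pres_pi (u + v).
Proof.
by apply/pres_piP; rewrite opprD addrACA; apply: ideal_genD; apply: pres_repr_pi.
Qed.

Let mulE u v : mul (pres_pi u) (pres_pi v) = pres_pi (u * v).
Proof.
apply/pres_piP; set u' := repr _; set v' := repr _.
have -> : u' * v' - u * v = (u' - u) * v' + u * (v' - v).
  by rewrite mulrBl mulrBr subrKA.
by apply: ideal_genD; [apply: ideal_genMr | apply: ideal_genMl];
  apply: pres_repr_pi.
Qed.

Let scaleE c u : scale c (pres_pi u) = pres_pi (c *: u).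
Proof.
apply/pres_piP; rewrite -scalerBr -[X in _ *: X]mul1r scalerAl.
exact/ideal_genMl/pres_repr_pi.
Qed.

Let piW (P : pres_alg -> Prop) : (forall u, P (pres_pi u)) -> forall x, P x.
Proof. by move=> Ppi x; rewrite -[x]pres_pi_repr. Qed.

Let addA : associative add.
Proof. by do 3!elim/piW=> ?; rewrite !addE addrA. Qed.

Let addC : commutative add.
Proof. by do 2!elim/piW=> ?; rewrite !addE addrC. Qed.

Let add0 : left_id zero add.
Proof. by elim/piW=> ?; rewrite addE add0r. Qed.

Let addN : left_inverse zero opp add.
Proof. by elim/piW=> ?; rewrite oppE addE addNr. Qed.

HB.instance Definition _ := GRing.isZmodule.Build pres_alg addA addC add0 addN.

Let pi_add u v : pres_pi u + pres_pi v = pres_pi (u + v).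
Proof. exact: addE. Qed.

Let mulA : associative mul.
Proof. by do 3!elim/piW=> ?; rewrite !mulE mulrA. Qed.

Let mul1 : left_id one mul.
Proof. by elim/piW=> ?; rewrite mulE mul1r. Qed.

Let mulr1' : right_id one mul.
Proof. by elim/piW=> ?; rewrite mulE mulr1. Qed.

Let mulDl : left_distributive mul +%R.
Proof. by do 3!elim/piW=> ?; rewrite !(pi_add, mulE) mulrDl. Qed.

Let mulDr : right_distributive mul +%R.
Proof. by do 3!elim/piW=> ?; rewrite !(pi_add, mulE) mulrDr. Qed.

HB.instance Definition _ :=
  GRing.Zmodule_isPzRing.Build pres_alg mulA mul1 mulr1' mulDl mulDr.

Let scaleA a b x : scale a (scale b x) = scale (a * b) x.
Proof. by elim/piW: x => ?; rewrite !scaleE scalerA. Qed.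

Let scale1 : left_id 1 scale.
Proof. by elim/piW=> ?; rewrite scaleE scale1r. Qed.

Let scaleDr : right_distributive scale +%R.
Proof. by move=> a; do 2!elim/piW=> ?; rewrite !(pi_add, scaleE) scalerDr. Qed.

Let scaleDl x : {morph scale^~ x : a b / a + b}.
Proof. by move=> a b; elim/piW: x => ?; rewrite !scaleE pi_add scalerDl. Qed.

HB.instance Definition _ :=
  GRing.Zmodule_isLmodule.Build F pres_alg scaleA scale1 scaleDr scaleDl.

Lemma pres_pi_is_zmod_morphism : zmod_morphism pres_pi.
Proof. by move=> u v; rewrite -pi_add; congr (_ + _); rewrite -oppE. Qed.

Lemma pres_pi_is_monoid_morphism : monoid_morphism pres_pi.
Proof. by split=> // u v; rewrite -mulE. Qed.

Lemma pres_pi_is_scalable : scalable pres_pi.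
Proof. by move=> c u; rewrite -scaleE. Qed.

HB.instance Definition _ :=
  GRing.isZmodMorphism.Build (free_alg F I) pres_alg pres_pi
    pres_pi_is_zmod_morphism.
HB.instance Definition _ :=
  GRing.isMonoidMorphism.Build (free_alg F I) pres_alg pres_pi
    pres_pi_is_monoid_morphism.
HB.instance Definition _ :=
  GRing.isScalable.Build F (free_alg F I) pres_alg *:%R pres_pi
    pres_pi_is_scalable.

Lemma pres_scalerAl (c : F) (x y : pres_alg) : c *: (x * y) = (c *: x) * y.
Proof.
elim/piW: x => u; elim/piW: y => v.
by rewrite -rmorphM -!linearZ -rmorphM /= scalerAl.
Qed.

Lemma pres_scalerAr (c : F) (x y : pres_alg) : c *: (x * y) = x * (c *: y).
Proof.
elim/piW: x => u; elim/piW: y => v.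
by rewrite -rmorphM -!linearZ -rmorphM /= free_alg_scalerAr.
Qed.

End PresentedAlgebra.

(* x_1, x_2, y_1, y_2 are the generators of index 0, 1, 2, 3. *)
Definition weyl2_rels (F : comNzRingType) :
    seq (free_alg F 'I_4 * free_alg F 'I_4) :=
  let x1 := free_gen F (@Ordinal 4 0 isT) in
  let x2 := free_gen F (@Ordinal 4 1 isT) in
  let y1 := free_gen F (@Ordinal 4 2 isT) in
  let y2 := free_gen F (@Ordinal 4 3 isT) in
  [:: (x1 * x2, x2 * x1);
      (y1 * y2, y2 * y1);
      (x1 * y2, y2 * x1);
      (x2 * y1, y1 * x2);
      (x1 * y1 - y1 * x1, 1);
      (x2 * y2 - y2 * x2, 1)].

Definition weyl2 (F : comNzRingType) := pres_alg (weyl2_rels F).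

(* f_2, ..., f_6 are the generators of index 0, ..., 4. *)
Definition R_rels (K : fieldType) :
    seq (free_alg K 'I_5 * free_alg K 'I_5) :=
  let f2 := free_gen K (@Ordinal 5 0 isT) in
  let f3 := free_gen K (@Ordinal 5 1 isT) in
  let f4 := free_gen K (@Ordinal 5 2 isT) in
  let f5 := free_gen K (@Ordinal 5 3 isT) in
  let f6 := free_gen K (@Ordinal 5 4 isT) in
  [:: (f3 * f2, f2 * f3);
      (f4 * f2, f2 * f4);
      (f4 * f3, f3 * f4);
      (f5 * f2, f2 * f5);
      (f5 * f4, f4 * f5);
      (f6 * f3, f3 * f6);
      (f6 * f4, f4 * f6);
      (f6 * f5, f5 * f6);
      (f4 ^+ 2, (1 / 9%:R : K)%:A);
      (f6 * f2, f2 * f6 + 1);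
      (f5 * f3, f3 * f5 - 1)].

Definition R_alg (K : fieldType) := pres_alg (R_rels K).

Definition f4_poly (K : fieldType) : {poly K} := 'X^2 - (1 / 9%:R)%:P.

(* {poly %/ p} is the quotient by p only when p is monic and nonconstant,
   which is the case here. *)
Definition F_alg (K : fieldType) := {poly %/ f4_poly K}.

Lemma mk_monic_f4_poly (K : fieldType) : mk_monic (f4_poly K) = f4_poly K.
Proof.
by rewrite /mk_monic size_XnsubC // monicXnsubC.
Qed.

HB.instance Definition _ K := GRing.ComUnitAlgebra.on (F_alg K).

(* Main.v *)
(* The isomorphism sends f_6, f_3 to x_1, x_2 and f_2, f_5 to y_1, y_2, and the
   central element f_4 to the class of 'X in K['X] / (f4_poly K).  Its inverse
   sends a scalar of F_alg K, the class of a polynomial p, to p(f_4).  Both maps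
   come from the universal property of presented algebras, and the composites
   are the identity because they fix scalars and generators. *)

Require Import Defs.
From mathcomp Require Import all_boot all_order all_algebra.
From HB Require Import structures.
From mathcomp Require Import finmap monalg.

Import GRing.Theory.
Local Open Scope ring_scope.

Set Implicit Arguments.
Unset Strict Implicit.

(** * The universal property of the free algebra *)

Section FreeLift.
Context {F : comNzRingType} {I : choiceType} {B : pzRingType}.
Context (phi : {rmorphism F -> B}) (g : I -> B).

Definition word_val (m : {fmonom I}) : B := \prod_(i <- (m : seq I)) g i.

(* [mmap] requires a nontrivial target ring, but a presented algebra may be
   zero. *)
Definition free_lift of (forall c i, GRing.comm (phi c) (g i)) :=
  fun u : free_alg F I => \sum_(m <- msupp u) phi (mcoeff m u) * word_val m.

Hypothesis comm_phi_g : forall c i, GRing.comm (phi c) (g i).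
Local Notation lift := (free_lift comm_phi_g).

(** Monomials outside the support contribute zero, so elements with different supports can be
    compared as sums over one common finite set. *)
Lemma free_liftEw (d : {fset {fmonom I}}) u : (msupp u `<=` d)%fset ->
  lift u = \sum_(m <- d) phi (mcoeff m u) * word_val m.
Proof.
move=> le_d; apply: big_fset_incl => // m _ /mcoeff_outdom ->.
by rewrite rmorph0 mul0r.
Qed.

Lemma free_liftU c m : lift << c *g m >> = phi c * word_val m.
Proof. by rewrite (free_liftEw msuppU_le) big_seq_fset1 mcoeffUU. Qed.

Lemma free_lift_is_zmod_morphism : zmod_morphism lift.
Proof.
move=> u v; pose d := (msupp u `|` msupp v)%fset.
rewrite (free_liftEw (msuppB_le u v)) (@free_liftEw d u) ?fsubsetUl //.
rewrite (@free_liftEw d v) ?fsubsetUr // -sumrB; apply: eq_bigr => m _.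
by rewrite mcoeffB rmorphB mulrBl.
Qed.

HB.instance Definition _ :=
  GRing.isZmodMorphism.Build (free_alg F I) B lift free_lift_is_zmod_morphism.

Lemma comm_phi_word_val c m : GRing.comm (phi c) (word_val m).
Proof. by apply: commr_prod => i _; apply: comm_phi_g. Qed.

Lemma word_valM m1 m2 : word_val (mmul m1 m2) = word_val m1 * word_val m2.
Proof. by rewrite /word_val fmM big_cat. Qed.

Lemma free_lift_is_monoid_morphism : monoid_morphism lift.
Proof.
split=> [|u v].
  by rewrite free_liftU rmorph1 mul1r /word_val fm1 big_nil.
rewrite malgME raddf_sum [lift u]/free_lift mulr_suml; apply: eq_bigr => m1 _.
rewrite raddf_sum /= [lift v]/free_lift mulr_sumr; apply: eq_bigr => m2 _.
rewrite free_liftU rmorphM word_valM -!mulrA; congr (_ * _).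
(* The coefficient from [v] has to move past the word from [u]; this is where commutation of scalars
   with generator images enters. *)
by rewrite !mulrA comm_phi_word_val.
Qed.

HB.instance Definition _ :=
  GRing.isMonoidMorphism.Build (free_alg F I) B lift
    free_lift_is_monoid_morphism.

Lemma free_lift_exists : exists h : {rmorphism free_alg F I -> B},
  (forall c, h c%:MP = phi c) /\ (forall i, h (free_gen F i) = g i).
Proof.
exists lift; split=> [c|i] /=; rewrite free_liftU /word_val.
  by rewrite fm1 big_nil mulr1.
by rewrite rmorph1 mul1r fmU big_seq1.
Qed.

End FreeLift.

(** An element is a finite sum of monomials, and each monomial is a scalar times a word, built one
    generator at a time from the list underlying it. *)
Lemma free_alg_ind {F : comNzRingType} {I : choiceType}
    (P : free_alg F I -> Prop) :
    (forall c, P c%:MP) -> (forall i, P (free_gen F i)) ->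
    (forall u v, P u -> P v -> P (u + v)) ->
    (forall u v, P u -> P v -> P (u * v)) ->
  forall u, P u.
Proof.
move=> PC Pg PD PM u; rewrite (monalgE u).
elim/big_ind: _ => // [|m _]; first by have := PC 0; rewrite raddf0.
have ->: << mcoeff m u *g m >> = (mcoeff m u)%:MP * << m >>.
  by rewrite malgM_def fgmulUU mulr1 mul1m.
apply: (PM) => //; case: m => s; elim: s => [|i s IHs].
  by have := PC 1; rewrite (_ : mone = FMonom [::]) //; apply/val_inj/fm1.
have ->: << FMonom (i :: s) >> = free_gen F i * << FMonom s >>.
  rewrite malgM_def fgmulUU mulr1; congr mkmalgU.
  by apply/val_inj; rewrite /= fmM fmU.
exact: PM.
Qed.

(** * Descent of morphisms to a presented algebra *)

Section PresLift.
Context {F : comNzRingType} {I : choiceType}.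
Context {rels : seq (free_alg F I * free_alg F I)} {B : pzRingType}.

Definition pres_lift (h : {rmorphism free_alg F I -> B})
    of {in rels, forall r, h r.1 = h r.2} :=
  fun x : pres_alg rels => h (repr x).

Context (h : {rmorphism free_alg F I -> B}).
Hypothesis h_rels : {in rels, forall r, h r.1 = h r.2}.

(** The choice of representative is harmless: two representatives differ by a sum of terms
    [a * s * b] with [s] a relator, and [h] kills every [s]. *)
Lemma pres_lift_pi u : pres_lift h_rels (pres_pi rels u) = h u.
Proof.
apply/eqP; rewrite -subr_eq0 -rmorphB; apply/eqP.
elim: (pres_repr_pi rels u) => [|a _ b v [r r_in ->] _ IHv].
  exact: rmorph0.
rewrite rmorphD IHv !rmorphM rmorphB /= (h_rels r_in) subrr.
by rewrite mulr0 mul0r addr0.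
Qed.

Lemma pres_lift_is_zmod_morphism : zmod_morphism (pres_lift h_rels).
Proof.
move=> x y; rewrite -(pres_pi_repr x) -(pres_pi_repr y) -rmorphB.
by rewrite !pres_lift_pi rmorphB.
Qed.

Lemma pres_lift_is_monoid_morphism : monoid_morphism (pres_lift h_rels).
Proof.
split=> [|x y]; first by rewrite -(rmorph1 (pres_pi rels)) pres_lift_pi rmorph1.
rewrite -(pres_pi_repr x) -(pres_pi_repr y) -rmorphM.
by rewrite !pres_lift_pi rmorphM.
Qed.

HB.instance Definition _ :=
  GRing.isZmodMorphism.Build (pres_alg rels) B (pres_lift h_rels)
    pres_lift_is_zmod_morphism.
HB.instance Definition _ :=
  GRing.isMonoidMorphism.Build (pres_alg rels) B (pres_lift h_rels)
    pres_lift_is_monoid_morphism.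

End PresLift.

(** * Scalars, equality of morphisms and polynomial evaluation in a presented algebra *)

Section PresTheory.
Context {F : comNzRingType} {I : choiceType}.
Context (rels : seq (free_alg F I * free_alg F I)).

(** The structure map of the algebra. The two algebras to compare have different base rings, so
    morphisms are ring morphisms whose effect on scalars is tracked through this map. *)
Definition pres_const : {rmorphism F -> pres_alg rels} :=
  pres_pi rels \o (@malgC {fmonom I} F).

Lemma pres_constE c : pres_const c = pres_pi rels c%:MP.
Proof. by []. Qed.

Lemma pres_pi_rels : {in rels, forall r, pres_pi rels r.1 = pres_pi rels r.2}.
Proof. by move=> r r_in; apply/pres_piP/ideal_gen_gen; exists r. Qed.

Lemma pres_rmorph_ext (B : pzRingType)
    (k1 k2 : {rmorphism pres_alg rels -> B}) :
    (forall c, k1 (pres_const c) = k2 (pres_const c)) ->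
    (forall i, k1 (pres_pi rels (free_gen F i)) =
               k2 (pres_pi rels (free_gen F i))) ->
  k1 =1 k2.
Proof.
move=> eqC eqg x; rewrite -(pres_pi_repr x).
elim/(@free_alg_ind F I): (repr x) => // u v IHu IHv.
  by rewrite !rmorphD IHu IHv.
by rewrite !rmorphM IHu IHv.
Qed.

Lemma mul_gmalgC (u : free_alg F I) c : u * c%:MP = c *: u.
Proof. by rewrite -[c%:MP]mulr1 mul_malgC -free_alg_scalerAr mulr1. Qed.

Lemma comm_pres_const c (x : pres_alg rels) : GRing.comm (pres_const c) x.
Proof.
rewrite -(pres_pi_repr x) /GRing.comm pres_constE -!rmorphM /=.
by rewrite mul_malgC mul_gmalgC.
Qed.

Lemma pres_scaleE c (x : pres_alg rels) : c *: x = pres_const c * x.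
Proof.
by rewrite -(pres_pi_repr x) -linearZ pres_constE -rmorphM /= mul_malgC.
Qed.

(* [horner_morph] requires a nontrivial target ring, so we evaluate in the
   free algebra. *)
Lemma pres_horner (x : pres_alg rels) :
  exists ev : {rmorphism {poly F} -> pres_alg rels},
    (forall c, ev c%:P = pres_const c) /\ ev 'X = x.
Proof.
have comm_repr : commr_rmorph (@malgC {fmonom I} F) (repr x).
  by move=> c; rewrite /GRing.comm mul_gmalgC mul_malgC.
exists (pres_pi rels \o horner_morph comm_repr).
by split=> [c|]; rewrite /= ?horner_morphC // horner_morphX pres_pi_repr.
Qed.

End PresTheory.

(** * Morphisms out of a polynomial quotient *)

Section QpolyLift.
Context {A : comNzRingType} {h : {poly A}} {B : pzRingType}.

Definition qpoly_lift (ev : {rmorphism {poly A} -> B})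
    of ev (mk_monic h) = 0 :=
  fun u : {poly %/ h} => ev (u : {poly A}).

Context (ev : {rmorphism {poly A} -> B}) (ev_h : ev (mk_monic h) = 0).

(** Division by the monic modulus changes [p] by a multiple of it, which [ev] sends to zero. *)
Lemma qpoly_lift_in_qpoly p : qpoly_lift ev_h (in_qpoly h p) = ev p.
Proof.
rewrite [in RHS](Pdiv.RingMonic.rdivp_eq (monic_mk_monic h) p).
by rewrite rmorphD rmorphM /= ev_h mulr0 add0r.
Qed.

Lemma qpoly_lift_is_zmod_morphism : zmod_morphism (qpoly_lift ev_h).
Proof. by move=> u v; apply: (rmorphB ev (u : {poly A}) v). Qed.

Lemma qpoly_lift_is_monoid_morphism : monoid_morphism (qpoly_lift ev_h).
Proof.
split=> [|u v]; first exact: rmorph1.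
by rewrite [LHS]qpoly_lift_in_qpoly rmorphM.
Qed.

HB.instance Definition _ :=
  GRing.isZmodMorphism.Build {poly %/ h} B (qpoly_lift ev_h)
    qpoly_lift_is_zmod_morphism.
HB.instance Definition _ :=
  GRing.isMonoidMorphism.Build {poly %/ h} B (qpoly_lift ev_h)
    qpoly_lift_is_monoid_morphism.

(** The stored polynomial is smaller than the modulus, hence is its own remainder. This lets any
    scalar be treated as the class of a polynomial. *)
Lemma in_qpoly_val (u : {poly %/ h}) : in_qpoly h (u : {poly A}) = u.
Proof. by apply/val_inj/Pdiv.CommonRing.rmodp_small/size_mk_monic. Qed.

End QpolyLift.

(** * Relations and universal properties of the second Weyl algebra and of R *)

Definition weyl2_relations {B : pzRingType} (x1 x2 y1 y2 : B) : Prop :=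
  [/\ x1 * x2 = x2 * x1, y1 * y2 = y2 * y1,
      x1 * y2 = y2 * x1 & x2 * y1 = y1 * x2] /\
  (x1 * y1 - y1 * x1 = 1 /\ x2 * y2 - y2 * x2 = 1).

(* Stated over an abstract ring: in the free algebra, conversion tests between
   distinct products unfold the convolution product and do not terminate in
   reasonable time. *)
Lemma weyl2_relations_morph (A B : pzRingType) (h : {rmorphism A -> B})
    (x1 x2 y1 y2 : A) :
  {in [:: (x1 * x2, x2 * x1); (y1 * y2, y2 * y1); (x1 * y2, y2 * x1);
          (x2 * y1, y1 * x2); (x1 * y1 - y1 * x1, 1); (x2 * y2 - y2 * x2, 1)],
    forall r, h r.1 = h r.2} <->
  weyl2_relations (h x1) (h x2) (h y1) (h y2).
Proof.
split.
  do 6!case/forall_cons=> /[swap]; move=> _ /=.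
  by rewrite !(rmorphM, rmorphB, rmorph1).
case=> -[? ? ? ?] [? ?] r; rewrite !inE.
do 5?[case/predU1P=> [->|]]; last move/eqP=> ->.
all: by rewrite /= ?(rmorphM, rmorphB, rmorph1).
Qed.

(** The generators are bound existentially, so later arguments see only their relations and the
    existence and uniqueness of morphisms, never products in the free algebra. *)
Lemma weyl2_presentation (F : comNzRingType) :
  exists x1 x2 y1 y2 : weyl2 F,
  [/\ weyl2_relations x1 x2 y1 y2,
      forall (B : pzRingType) (phi : {rmorphism F -> B}) (a1 a2 b1 b2 : B),
        {in [:: a1; a2; b1; b2], forall b c, GRing.comm (phi c) b} ->
        weyl2_relations a1 a2 b1 b2 ->
        exists k : {rmorphism weyl2 F -> B},
          (forall c, k (pres_const (weyl2_rels F) c) = phi c) /\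
          [/\ k x1 = a1, k x2 = a2, k y1 = b1 & k y2 = b2] &
      forall (B : pzRingType) (k1 k2 : {rmorphism weyl2 F -> B}),
        (forall c, k1 (pres_const (weyl2_rels F) c) =
                   k2 (pres_const (weyl2_rels F) c)) ->
        [/\ k1 x1 = k2 x1, k1 x2 = k2 x2, k1 y1 = k2 y1 & k1 y2 = k2 y2] ->
        k1 =1 k2].
Proof.
pose x i := pres_pi (weyl2_rels F) (free_gen F i).
exists (x (@Ordinal 4 0 isT)), (x (@Ordinal 4 1 isT)).
exists (x (@Ordinal 4 2 isT)), (x (@Ordinal 4 3 isT)); split.
- exact/weyl2_relations_morph/(@pres_pi_rels _ _ (weyl2_rels F)).
- move=> B phi a1 a2 b1 b2 comm_phi rel_ab.
  pose img (i : 'I_4) := nth 0 [:: a1; a2; b1; b2] i.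
  have comm_img c i : GRing.comm (phi c) (img i).
    by apply: comm_phi; apply: mem_nth.
  have [h [hC hg]] := free_lift_exists comm_img.
  have h_rels : {in weyl2_rels F, forall r, h r.1 = h r.2}.
    (* The goal becomes an equality of two propositions, settled argument by argument with [hg]. *)
    apply/weyl2_relations_morph; apply: (eq_ind_r id rel_ab).
    by congr (weyl2_relations _ _ _ _); apply: hg.
  exists (pres_lift h_rels); split=> [c|].
    by rewrite [LHS]pres_lift_pi hC.
  by split; rewrite [LHS]pres_lift_pi hg.
- move=> B k1 k2 eqC [eq0 eq1 eq2 eq3].
  apply: pres_rmorph_ext; first exact: eqC.
  case=> [[|[|[|[|i]]]] lt_i]; last by case: (notF lt_i).
  (* The bound proof inside each ordinal is replaced by the [isT] used for the chosen generators. *)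
  all: rewrite (bool_irrelevance lt_i isT).
  all: [> exact: eq0 | exact: eq1 | exact: eq2 | exact: eq3].
Qed.

(** The relations are regrouped: commutations among [f2], [f3], [f5], [f6], then centrality of [f4],
    then the rest. The parameter [c] stands for the image of the scalar 1/9. *)
Definition R_relations {B : pzRingType} (f2 f3 f4 f5 f6 c : B) : Prop :=
  [/\ f3 * f2 = f2 * f3, f5 * f2 = f2 * f5,
      f6 * f3 = f3 * f6 & f6 * f5 = f5 * f6] /\
  [/\ f4 * f2 = f2 * f4, f4 * f3 = f3 * f4,
      f5 * f4 = f4 * f5 & f6 * f4 = f4 * f6] /\
  [/\ f4 ^+ 2 = c, f6 * f2 = f2 * f6 + 1 & f5 * f3 = f3 * f5 - 1].

Lemma R_relations_morph (A B : pzRingType) (h : {rmorphism A -> B})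
    (f2 f3 f4 f5 f6 c : A) :
  {in [:: (f3 * f2, f2 * f3); (f4 * f2, f2 * f4); (f4 * f3, f3 * f4);
          (f5 * f2, f2 * f5); (f5 * f4, f4 * f5); (f6 * f3, f3 * f6);
          (f6 * f4, f4 * f6); (f6 * f5, f5 * f6); (f4 ^+ 2, c);
          (f6 * f2, f2 * f6 + 1); (f5 * f3, f3 * f5 - 1)],
    forall r, h r.1 = h r.2} <->
  R_relations (h f2) (h f3) (h f4) (h f5) (h f6) (h c).
Proof.
split.
  do 11!case/forall_cons=> /[swap]; move=> _ /=.
  by rewrite !(rmorphXn, rmorphB, rmorphD, rmorphM, rmorph1).
case=> -[? ? ? ?] [[? ? ? ?] [? ? ?]] r; rewrite !inE.
do 10?[case/predU1P=> [->|]]; last move/eqP=> ->.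
all: by rewrite /= ?(rmorphXn, rmorphB, rmorphD, rmorphM, rmorph1).
Qed.

Lemma R_presentation (K : fieldType) :
  exists f2 f3 f4 f5 f6 : R_alg K,
  [/\ R_relations f2 f3 f4 f5 f6 (pres_const (R_rels K) (1 / 9%:R)),
      forall (B : pzRingType) (phi : {rmorphism K -> B}) (b2 b3 b4 b5 b6 : B),
        {in [:: b2; b3; b4; b5; b6], forall b c, GRing.comm (phi c) b} ->
        R_relations b2 b3 b4 b5 b6 (phi (1 / 9%:R)) ->
        exists k : {rmorphism R_alg K -> B},
          (forall c, k (pres_const (R_rels K) c) = phi c) /\
          [/\ k f2 = b2, k f3 = b3, k f4 = b4, k f5 = b5 & k f6 = b6] &
      forall (B : pzRingType) (k1 k2 : {rmorphism R_alg K -> B}),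
        (forall c, k1 (pres_const (R_rels K) c) =
                   k2 (pres_const (R_rels K) c)) ->
        [/\ k1 f2 = k2 f2, k1 f3 = k2 f3, k1 f4 = k2 f4, k1 f5 = k2 f5 &
            k1 f6 = k2 f6] ->
        k1 =1 k2].
Proof.
(* [R_rels] writes 1/9 as a multiple of the unit, whereas [pres_const] goes through constant
   elements. *)
have scalarE : (1 / 9%:R : K)%:A = (1 / 9%:R : K)%:MP :> free_alg K 'I_5.
  by rewrite -mul_malgC mulr1.
pose x i := pres_pi (R_rels K) (free_gen K i).
exists (x (@Ordinal 5 0 isT)), (x (@Ordinal 5 1 isT)), (x (@Ordinal 5 2 isT)).
exists (x (@Ordinal 5 3 isT)), (x (@Ordinal 5 4 isT)); split.
- rewrite pres_constE -scalarE.
  exact/R_relations_morph/(@pres_pi_rels _ _ (R_rels K)).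
- move=> B phi b2 b3 b4 b5 b6 comm_phi rel_b.
  pose img (i : 'I_5) := nth 0 [:: b2; b3; b4; b5; b6] i.
  have comm_img c i : GRing.comm (phi c) (img i).
    by apply: comm_phi; apply: mem_nth.
  have [h [hC hg]] := free_lift_exists comm_img.
  have h_rels : {in R_rels K, forall r, h r.1 = h r.2}.
    apply/R_relations_morph; apply: (eq_ind_r id rel_b).
    congr (R_relations _ _ _ _ _ _);
      [apply: hg..|rewrite scalarE; apply: hC].
  exists (pres_lift h_rels); split=> [c|].
    by rewrite [LHS]pres_lift_pi hC.
  by split; rewrite [LHS]pres_lift_pi hg.
- move=> B k1 k2 eqC [eq0 eq1 eq2 eq3 eq4].
  apply: pres_rmorph_ext; first exact: eqC.
  case=> [[|[|[|[|[|i]]]]] lt_i]; last by case: (notF lt_i).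
  all: rewrite (bool_irrelevance lt_i isT).
  all: [> exact: eq0 | exact: eq1 | exact: eq2 | exact: eq3 | exact: eq4].
Qed.

(** * Translation between the two sets of relations *)

Lemma weyl2_R_relations (B : pzRingType) (x1 x2 y1 y2 t c : B) :
    weyl2_relations x1 x2 y1 y2 -> (forall x, t * x = x * t) -> t ^+ 2 = c ->
  R_relations y1 x2 t y2 x1 c.
Proof.
move=> [[x12 y12 x1y2 x2y1] [x1y1 x2y2]] t_central t2.
split; first by split.
split; first by split; rewrite t_central.
(* The first [1] becomes the commutator of [x1] and [y1], the other that of [x2] and [y2]. *)
by rewrite -{1}x1y1 -x2y2 opprB !(addrC _ (_ - _)) !subrK.
Qed.

Lemma R_weyl2_relations (B : pzRingType) (f2 f3 f4 f5 f6 c : B) :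
  R_relations f2 f3 f4 f5 f6 c -> weyl2_relations f6 f3 f2 f5.
Proof.
move=> [[f32 f52 f63 f65] [_ [_ f62 f53]]]; split; first by split.
by rewrite f62 f53 opprB addrAC subrr add0r addrCA subrr addr0.
Qed.

Lemma R_relations_comm (B : pzRingType) (f2 f3 f4 f5 f6 c : B) :
    R_relations f2 f3 f4 f5 f6 c ->
  {in [:: f6; f3; f2; f5], forall b, GRing.comm b f4}.
Proof.
by move=> [_ [[f42 f43 f54 f64] _]] b; rewrite !inE => /or4P[] /eqP->.
Qed.

(** * Construction of the two mutually inverse morphisms *)

Unset Implicit Arguments.

Theorem corollary4p10 (K : fieldType) (charK : 3%N \notin [pchar K]) :
  exists f : {rmorphism R_alg K -> weyl2 (F_alg K)},
    bijective f /\
    forall (c : K) (a : R_alg K), f (c *: a) = (c%:A : F_alg K) *: f a.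
Proof.
have [x1 [x2 [y1 [y2 [relW liftW extW]]]]] := weyl2_presentation (F_alg K).
have [f2 [f3 [f4 [f5 [f6 [relR liftR extR]]]]]] := R_presentation K.
have [_ [_ [f4_sqr _ _]]] := relR.
pose F_to_W := pres_const (weyl2_rels (F_alg K)).
have F_comm u x : F_to_W u * x = x * F_to_W u by apply: comm_pres_const.
pose K_to_W : {rmorphism K -> weyl2 (F_alg K)} := F_to_W \o in_alg (F_alg K).
pose tau : F_alg K := in_qpoly (f4_poly K) 'X.
have qpolyC c : in_qpoly (f4_poly K) c%:P = c%:A.
  by rewrite -alg_polyC linearZ rmorph1.
have K_to_WE c : K_to_W c = F_to_W (in_qpoly (f4_poly K) c%:P).
  by rewrite qpolyC.
have tau2 : tau ^+ 2 = (1 / 9%:R : K)%:A.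
  apply/eqP; rewrite -subr_eq0 /tau -rmorphXn -qpolyC -rmorphB /=.
  (* The polynomial is already monic, so the modulus is [f4_poly K] itself, whose remainder modulo
     itself is zero. *)
  apply/eqP/val_inj; rewrite /= mk_monic_f4_poly.
  exact/Pdiv.RingMonic.rmodpp/monicXnsubC.
have [|| f [fC [f_f2 f_f3 f_f4 f_f5 f_f6]]] :=
  liftR _ K_to_W y1 x2 (F_to_W tau) y2 x1.
- by move=> b _ c; apply: comm_pres_const.
- apply: weyl2_R_relations relW _ _; first exact: F_comm.
  by rewrite -rmorphXn tau2.
have [ev [evC evX]] := pres_horner f4.
(* Evaluation at [f4] factors through the quotient because [f4] squares to 1/9 in R. *)
have ev_f4 : ev (mk_monic (f4_poly K)) = 0.
  by rewrite mk_monic_f4_poly rmorphB rmorphXn /= evX evC f4_sqr subrr.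
pose psi : {rmorphism F_alg K -> R_alg K} := qpoly_lift ev_f4.
have psiE p : psi (in_qpoly (f4_poly K) p) = ev p by apply: qpoly_lift_in_qpoly.
have [|| g [gC [g_x1 g_x2 g_y1 g_y2]]] := liftW _ psi f6 f3 f2 f5.
- move=> b b_in u; apply: commr_sym; rewrite -(in_qpoly_val u) psiE.
  have comm_f4 : GRing.comm b f4 by exact: R_relations_comm relR _ b_in.
  (* Horner induction: [b] commutes with [f4] and with constants, hence with every polynomial in
     [f4]. *)
  elim/poly_ind: (polyn u) => [|p c IHp].
    by rewrite rmorph0; apply: commr0.
  rewrite rmorphD rmorphM /= evX evC; apply: commrD; first exact: commrM.
  exact/commr_sym/comm_pres_const.
- exact: R_weyl2_relations relR.
exists f; split; last first.
  (* Scaling is multiplication by the image of the scalar on both sides, and [fC] matches the image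
     of [c] with that of [c%:A]. *)
  by move=> c a; rewrite !pres_scaleE rmorphM fC.
exists g.
  apply: (extR _ (g \o f) idfun) => [c|] /=.
    (* A scalar [c] passes through the class of the constant polynomial [c%:P], whose evaluation at
       [f4] is [c] again. *)
    apply: etrans (congr1 g (etrans (fC c) (K_to_WE c))) _.
    exact: etrans (gC _) (etrans (psiE _) (evC c)).
  by rewrite f_f2 f_f3 f_f4 f_f5 f_f6 g_x1 g_x2 g_y1 g_y2 gC psiE evX.
apply: (extW _ (f \o g) idfun) => [u|] /=.
  (* Horner induction on a representative of [u]: [ev] replaces the variable by [f4], and [f] sends
     [f4] to the image of [tau], the class of ['X], so the class of the same polynomial is
     rebuilt. *)
  rewrite gC -(in_qpoly_val u) psiE; elim/poly_ind: (polyn u) => [|p c IHp].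
    by rewrite !rmorph0.
  by rewrite !(rmorphD, rmorphM) /= IHp evX evC fC K_to_WE f_f4.
by rewrite g_x1 g_x2 g_y1 g_y2.
Qed.
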